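(* $$\lim_{p\to\infty}\sigma(p\text{-Set Cover}/n)\le\lim_{p\to\infty}\sigma(p\text{-Set Partitioning}/n).$$
   Context: For a problem $\Pi$ with input size $m$ and parameter $n$, $\sigma(\Pi/n)$ is the infimum of all $\epsilon>0$ such that $\Pi$ has a randomized algorithm with error probability at most $1/3$ running in time $2^{\epsilon n}\mathrm{poly}(m)$. $p$-Set Cover: given an integer $t$ and $\mathcal F\subseteq 2^U$, $|U|=n$, every set of size at most $p$, decide whether some $\mathcal C\subseteq\mathcal F$ with $|\mathcal C|\le t$ satisfies $\bigcup_{S\in\mathcal C}S=U$. $p$-Set Partitioning: given an integer $t$ and $\mathcal F\subseteq 2^U$, $|U|=n$, every set of size at most $p$, decide whether there is $\mathcal C\subseteq\mathcal F$ with $|\mathcal C|=t$, $\bigcup_{S\in\mathcal C}S=U$, and the members of $\mathcal C$ pairwise disjoint. *)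

(* Defs.v *)
From HB Require Import structures.
From mathcomp Require Import all_boot all_order all_algebra.
From mathcomp Require Import all_classical all_reals all_analysis.

Set Implicit Arguments.
Unset Strict Implicit.
Unset Printing Implicit Defensive.

Import Order.TTheory GRing.Theory Num.Theory.

(* Randomized algorithms are structured programs for a random access machine
   with logarithmic cost.  The machine has named registers (a program mentions
   finitely many of them), a memory indexed by nat and read and written through
   registers, and a source of fair coins.  Values are natural numbers of
   unbounded size; the cost of an elementary action is the number of bits of
   the addresses and operands that it handles. *)

Inductive prog : Type :=
| Skip
| Const (x c : nat)    (* x := c *)
| Plus (x y z : nat)   (* x := y + z *)
| Minus (x y z : nat)  (* x := y - z, truncated at 0 *)
| Read (x y : nat)     (* x := ram[y] *)
| Write (x y : nat)    (* ram[x] := y *)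
| Flip (x : nat)       (* x := next coin *)
| Seq (P Q : prog)
| If (x : nat) (P Q : prog)  (* a register is true when nonzero *)
| While (x : nat) (P : prog).

Record state : Type := State { reg : nat -> nat; ram : nat -> nat }.

Definition upd (f : nat -> nat) (i v : nat) : nat -> nat :=
  fun j => if j == i then v else f j.

Definition set_reg (s : state) (x v : nat) : state :=
  State (upd (reg s) x v) (ram s).

Definition set_ram (s : state) (a v : nat) : state :=
  State (reg s) (upd (ram s) a v).

(* Number of binary digits; 0 is written with one digit. *)
Definition bitlen (v : nat) : nat := (trunc_log 2 v).+1.

(* [exec P s r k s' r']: started in state s with the coins r still to come, P
   terminates in state s' at cost k, leaving the coins r'.  A flip with no coin
   left does not terminate. *)
Inductive exec : prog -> state -> seq bool -> nat -> state -> seq bool -> Prop :=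
| ExecSkip s r : exec Skip s r 1 s r
| ExecConst x c s r :
    exec (Const x c) s r (bitlen c) (set_reg s x c) r
| ExecPlus x y z s r :
    exec (Plus x y z) s r (bitlen (reg s y) + bitlen (reg s z))
      (set_reg s x (reg s y + reg s z)) r
| ExecMinus x y z s r :
    exec (Minus x y z) s r (bitlen (reg s y) + bitlen (reg s z))
      (set_reg s x (reg s y - reg s z)) r
| ExecRead x y s r :
    exec (Read x y) s r (bitlen (reg s y) + bitlen (ram s (reg s y)))
      (set_reg s x (ram s (reg s y))) r
| ExecWrite x y s r :
    exec (Write x y) s r (bitlen (reg s x) + bitlen (reg s y))
      (set_ram s (reg s x) (reg s y)) r
| ExecFlip x (b : bool) s r :
    exec (Flip x) s (b :: r) 1 (set_reg s x b) r
| ExecSeq P Q s r k1 s1 r1 k2 s2 r2 :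
    exec P s r k1 s1 r1 -> exec Q s1 r1 k2 s2 r2 ->
    exec (Seq P Q) s r (k1 + k2) s2 r2
| ExecIfTrue x P Q s r k s' r' :
    reg s x != 0 -> exec P s r k s' r' ->
    exec (If x P Q) s r (bitlen (reg s x) + k) s' r'
| ExecIfFalse x P Q s r k s' r' :
    reg s x = 0 -> exec Q s r k s' r' ->
    exec (If x P Q) s r (bitlen (reg s x) + k) s' r'
| ExecWhileTrue x P s r k1 s1 r1 k2 s2 r2 :
    reg s x != 0 -> exec P s r k1 s1 r1 -> exec (While x P) s1 r1 k2 s2 r2 ->
    exec (While x P) s r (bitlen (reg s x) + k1 + k2) s2 r2
| ExecWhileFalse x P s r :
    reg s x = 0 -> exec (While x P) s r (bitlen (reg s x)) s r.

(* The input word occupies the first memory cells, everything else is 0. *)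
Definition init (w : seq nat) : state := State (fun=> 0) (nth 0 w).

(* The answer is read in register 0. *)
Definition answers (P : prog) (w : seq nat) (r : seq bool) (T : nat) (b : bool)
    : Prop :=
  exists k s r', [/\ exec P (init w) r k s r', k <= T & (reg s 0 != 0) = b].

(* Coins cost 1 each, so a run of cost at most T is determined by T coins and
   probabilities are proportions of the T-tuples of coins. *)
Definition runs_in (P : prog) (w : seq nat) (T : nat) : Prop :=
  forall r : T.-tuple bool, exists b, answers P w r T b.

Definition error_count (P : prog) (w : seq nat) (T : nat) (b : bool) : nat :=
  #|[pred r : T.-tuple bool | `[< answers P w r T (~~ b) >]]|.

Definition error_prob (R : realType) (P : prog) (w : seq nat) (T : nat)
    (b : bool) : R :=
  ((error_count P w T b)%:R / (2 ^ T)%:R)%R.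

(* Parameterized decision problems. An instance may have several encodings, on
   each of which an algorithm has to be correct. *)
Record problem : Type := Problem {
  instance : Type;
  encodes : instance -> seq nat -> Prop;
  param : instance -> nat;
  yes : instance -> bool
}.

Definition input_size (w : seq nat) : nat := \sum_(v <- w) bitlen v.

Definition solvable (R : realType) (Pi : problem) (eps : R) : Prop :=
  exists (P : prog) (q : {poly nat}),
    forall (I : instance Pi) (w : seq nat), encodes I w ->
    exists T : nat,
      [/\ (T%:R <= 2 `^ (eps * (param I)%:R) * (q.[input_size w])%:R)%R,
          runs_in P w T
        & (error_prob R P w T (yes I) <= 1 / 3)%R].

Definition sigma (R : realType) (Pi : problem) : \bar R :=
  ereal_inf [set eps%:E | eps in [set e : R | (0 < e)%R /\ solvable Pi e]]%classic.

(* The universe of size n is 'I_n. *)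
Record bounded_family (p : nat) : Type := BoundedFamily {
  univ : nat;
  target : int;
  members : {set {set 'I_univ}};
  members_le : forall A : {set 'I_univ}, A \in members -> #|A| <= p
}.

Definition char_vector (n : nat) (A : {set 'I_n}) : seq nat :=
  [seq nat_of_bool (i \in A) | i <- enum 'I_n].

(* n, sign and absolute value of t, number of sets, then the sets themselves. *)
Definition family_word (n : nat) (t : int) (s : seq {set 'I_n}) : seq nat :=
  [:: n; nat_of_bool (t < 0)%R; `|t|%N; size s]
    ++ flatten [seq char_vector A | A <- s].

(* The members of the family are listed without repetition, in any order. *)
Definition family_encodes (p : nat) (I : bounded_family p) (w : seq nat) : Prop :=
  exists2 s : seq {set 'I_(univ I)},
    perm_eq s (enum (members I)) & w = family_word (target I) s.

Definition has_cover (p : nat) (I : bounded_family p) : bool :=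
  [exists C : {set {set 'I_(univ I)}},
    [&& C \subset members I, (#|C|%:Z <= target I)%R
      & finset.cover C == [set: 'I_(univ I)]%SET]].

Definition has_partitioning (p : nat) (I : bounded_family p) : bool :=
  [exists C : {set {set 'I_(univ I)}},
    [&& C \subset members I, (#|C|%:Z == target I)%R,
        finset.cover C == [set: 'I_(univ I)]%SET
      & finset.trivIset C]].

Definition set_cover (p : nat) : problem :=
  @Problem (bounded_family p) (@family_encodes p) (@univ p) (@has_cover p).

Definition set_partitioning (p : nat) : problem :=
  @Problem (bounded_family p) (@family_encodes p) (@univ p) (@has_partitioning p).

(* Main.v *)
(* A family and its closure under subsets have the same covers, up to enlarging
   the members, and over the closure a cover shrinks to a partition.  A partition
   by members of the closure with fewer than n parts can be refined one part at a
   time, so there is a cover with at most t sets if and only if the closure has a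
   partition into exactly min(t, n) sets.  For fixed p the closure is at most 2^p
   times larger than the family, so one call to p-Set Partitioning, on the same
   universe and after a polynomial computation, solves p-Set Cover.  Both exponents
   are nondecreasing in p, hence the limits exist.

   The closure is computed in place: for each element j, append A \ {j} for every
   listed set A, unless it is listed already. *)
Require Import Defs.
From mathcomp Require Import all_boot all_order all_algebra.
From mathcomp Require Import all_classical all_reals all_analysis.
From mathcomp Require Import zify.

Set Implicit Arguments.
Unset Strict Implicit.
Unset Printing Implicit Defensive.

Import Order.TTheory GRing.Theory Num.Theory.
Local Open Scope set_scope.

(** * Composing a program with a coin-free translation *)

Lemma exec_cat P s r k s' r' u :
  exec P s r k s' r' -> exec P s (r ++ u) k s' (r' ++ u).
Proof. by elim=> *; econstructor; eauto. Qed.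

Lemma exec_det P s r k s' r' k1 s1 r1 :
  exec P s r k s' r' -> exec P s r k1 s1 r1 -> [/\ k1 = k, s1 = s' & r1 = r'].
Proof.
move=> E; elim: E k1 s1 r1 => {P s r k s' r'}.
- by move=> s r k1 s1 r1 E; inversion E.
- by move=> x c s r k1 s1 r1 E; inversion E.
- by move=> x y z s r k1 s1 r1 E; inversion E.
- by move=> x y z s r k1 s1 r1 E; inversion E.
- by move=> x y s r k1 s1 r1 E; inversion E.
- by move=> x y s r k1 s1 r1 E; inversion E.
- by move=> x b s r k1 s1 r1 E; inversion E.
- move=> P Q s r k1 s1 r1 k2 s2 r2 _ IH1 _ IH2 k s' r' E; inversion E; subst.
  match goal with HP : exec P _ _ _ _ _, HQ : exec Q _ _ _ _ _ |- _ =>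
    case: (IH1 _ _ _ HP) => ? ? ?; subst; by case: (IH2 _ _ _ HQ) => -> -> -> end.
- move=> x P Q s r k s' r' /eqP h _ IH k1 s1 r1 E; inversion E; clear E; subst => //.
  match goal with HP : exec P _ _ _ _ _ |- _ =>
    by case: (IH _ _ _ HP) => -> -> -> end.
- move=> x P Q s r k s' r' h _ IH k1 s1 r1 E; inversion E; subst.
    by match goal with h' : is_true _ |- _ => rewrite h in h' end.
  match goal with HQ : exec Q _ _ _ _ _ |- _ =>
    by case: (IH _ _ _ HQ) => -> -> -> end.
- move=> x P s r k1 s1 r1 k2 s2 r2 /eqP h _ IH1 _ IH2 k s' r' E.
  inversion E; clear E; subst => //.
  match goal with HP : exec P _ _ _ _ _, HW : exec (While x P) _ _ _ _ _ |- _ =>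
    case: (IH1 _ _ _ HP) => ? ? ?; subst; by case: (IH2 _ _ _ HW) => -> -> -> end.
- move=> x P s r h k s' r' E; inversion E; clear E; subst => //.
  by match goal with h' : is_true _ |- _ => rewrite h in h' end.
Qed.

Lemma answers_cat P w r u T b : answers P w r T b -> answers P w (r ++ u) T b.
Proof.
case=> k [s] [r'] [E kT sb]; exists k, s, (r' ++ u).
by split=> //; exact: exec_cat.
Qed.

Lemma answers_inj P w r T T' b b' :
  answers P w r T b -> answers P w r T' b' -> b = b'.
Proof.
case=> k [s] [r1] [E _ <-] [k'] [s'] [r1'] [E' _ <-].
by have [_ -> _] := exec_det E E'.
Qed.

Section Reduction.

Variables (Q P : prog) (w w' : seq nat) (k : nat).
Hypothesis translates : forall r, exec Q (init w) r k (init w') r.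

Lemma answers_seq r T b :
  answers (Seq Q P) w r (k + T) b <-> answers P w' r T b.
Proof.
split.
  case=> k0 [s] [r'] [E kT sb]; inversion E; subst.
  match goal with HQ : exec Q _ _ _ _ _ |- _ =>
    have [? ? ?] := exec_det (translates r) HQ; subst end.
  by exists k2, s, r'; split=> //; rewrite leq_add2l in kT.
case=> k0 [s] [r'] [E kT sb]; exists (k + k0), s, r'; split=> //.
  exact: ExecSeq E.
by rewrite leq_add2l.
Qed.

(** The composite receives [k + T] coins because its time bound is longer, but [Q] consumes none.
    [P] already answers on the first [T] of them, and by determinism the remaining coins cannot
    change that answer. *)
Lemma answers_seq_take (r : seq bool) T b : runs_in P w' T -> size r = k + T ->
  answers (Seq Q P) w r (k + T) b <-> answers P w' (take T r) T b.
Proof.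
move=> run szr; rewrite answers_seq; split=> [ans|/(@answers_cat _ _ _ (drop T r))].
  have sz : size (take T r) == T by rewrite size_takel // szr leq_addl.
  have [b' ans'] := run (Tuple sz).
  suff -> : b = b' by [].
  apply: answers_inj ans _; rewrite -(cat_take_drop T r).
  exact: (answers_cat _ ans').
by rewrite cat_take_drop.
Qed.

Lemma runs_in_seq T : runs_in P w' T -> runs_in (Seq Q P) w (k + T).
Proof.
move=> run r; have sz : size (take T r) == T.
  by rewrite size_takel // size_tuple leq_addl.
have [b ans] := run (Tuple sz); exists b.
exact: (answers_seq_take _ run (size_tuple r)).2 ans.
Qed.

(** Cutting a tuple after its first [T] coins injects the bad tuples of the composite into the pairs
    of a bad [T]-tuple and an arbitrary [k]-tuple. The factor [2 ^ k] cancels in the probability. *)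
Lemma error_count_seq T b : runs_in P w' T ->
  error_count (Seq Q P) w (k + T) b <= error_count P w' T b * 2 ^ k.
Proof.
move=> run; rewrite /error_count.
have szt (r : (k + T).-tuple bool) : size (take T r) == T.
  by rewrite size_takel // size_tuple leq_addl.
have szd (r : (k + T).-tuple bool) : size (drop T r) == k.
  by rewrite size_drop size_tuple addnK.
pose f (r : (k + T).-tuple bool) := (Tuple (szt r), Tuple (szd r)).
have fI : injective f.
  move=> r r' [et ed]; apply/val_inj => /=.
  by rewrite -(cat_take_drop T r) et ed cat_take_drop.
rewrite -(fintype.card_image fI).
have -> : 2 ^ k = #|{: k.-tuple bool}| by rewrite card_tuple card_bool.
rewrite -cardX; apply/subset_leq_card/fintype.subsetP => _ /fintype.imageP[r rP ->].
rewrite !inE /= andbT; move: rP; rewrite unfold_in => /asboolP ans; apply/asboolP.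
exact: (answers_seq_take _ run (size_tuple r)).1 ans.
Qed.

Lemma error_prob_seq (R : realType) T b : runs_in P w' T ->
  (error_prob R (Seq Q P) w (k + T) b <= error_prob R P w' T b)%R.
Proof.
move=> run; rewrite /error_prob ler_pdivrMr ?ltr0n ?expn_gt0 //.
rewrite expnD natrM mulrCA divfK ?pnatr_eq0 ?expn_eq0 //.
by rewrite -natrM ler_nat mulnC error_count_seq.
Qed.

End Reduction.

(** * Closure under subsets *)

Section Closure.

Variable n : nat.
Implicit Types (s t : seq {set 'I_n}) (j : 'I_n) (F : {set {set 'I_n}}).

Definition add_row s (A : {set 'I_n}) := if A \in s then s else rcons s A.

(** [foldr] treats the last set first, as the loops of the program count down. The sets appended on
    the way are not visited: they lack [j], so deleting [j] from them gives nothing new. *)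
Definition stage j s := foldr (fun A t => add_row t (A :\ j)) s s.

Definition close_rows s := foldr stage s (enum 'I_n).

Definition downset F : {set {set 'I_n}} :=
  [set A : {set 'I_n} | [exists B in F, A \subset B]].

Lemma mem_add_row s A X : (X \in add_row s A) = (X \in s) || (X == A).
Proof.
rewrite /add_row; case: ifP => As; last by rewrite mem_rcons inE orbC.
by case: eqVneq => [->|_]; rewrite ?As ?orbF.
Qed.

Lemma uniq_add_row s A : uniq s -> uniq (add_row s A).
Proof. by rewrite /add_row; case: ifPn => // As us; rewrite rcons_uniq As. Qed.

Lemma uniq_foldr_add_row j t s :
  uniq t -> uniq (foldr (fun (A : {set 'I_n}) u => add_row u (A :\ j)) t s).
Proof. by move=> ut; elim: s => //= A s; exact: uniq_add_row. Qed.

(** Sets are only appended, so those listed before a stage keep their positions in memory while the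
    program runs through them. *)
Lemma prefix_foldr_add_row j t s :
  prefix t (foldr (fun (A : {set 'I_n}) u => add_row u (A :\ j)) t s).
Proof.
elim: s => [|A s IH] /=; first exact: prefix_refl.
rewrite {1}/add_row; case: ifP => // _.
by apply: prefix_trans IH _; rewrite -cats1 prefix_prefix.
Qed.

Lemma mem_foldr_add_row j t s X :
  (X \in foldr (fun (A : {set 'I_n}) u => add_row u (A :\ j)) t s) =
  (X \in t) || (X \in [seq (A : {set 'I_n}) :\ j | A <- s]).
Proof.
elim: s => [|A s IH] /=; first by rewrite orbF.
by rewrite mem_add_row IH inE -orbA [(_ \in map _ _) || _]orbC.
Qed.

Lemma uniq_foldr_stage s js : uniq s -> uniq (foldr stage s js).
Proof. by move=> us; elim: js => //= j js; exact: uniq_foldr_add_row. Qed.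

(** Induction on [js]: if [j] is in [A] but not in [X], then [X] arises by deleting [j] from
    [j |: X], which is listed already because only elements of [js] separate it from [A]. *)
Lemma mem_foldr_stage s js X :
  (X \in foldr stage s js) =
  has (fun A : {set 'I_n} => (X \subset A) && [forall j, (j \in A :\: X) ==> (j \in js)]) s.
Proof.
elim: js X => [|j js IH] X /=.
  apply/idP/hasP => [Xs|[A As /andP[XA /forallP AX]]].
    by exists X => //; rewrite subxx /=; apply/forallP => j; rewrite finset.setDv inE.
  suff -> : X = A by [].
  apply/eqP; rewrite finset.eqEsubset XA /=; apply/fintype.subsetP => i iA.
  by have := AX i; rewrite finset.in_setD iA andbT in_nil implybF negbK.
rewrite {1}/stage mem_foldr_add_row IH; apply/orP/hasP => [[]|].
- case/hasP=> A As /andP[XA /forallP AX]; exists A => //; rewrite XA /=.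
  by apply/forallP => i; apply/implyP => /(implyP (AX i)); rewrite inE orbC => ->.
- case/mapP=> B; rewrite IH => /hasP[A As /andP[BA /forallP AB]] ->.
  exists A => //; rewrite (fintype.subset_trans (subD1set _ _) BA) /=.
  apply/forallP => i; apply/implyP; have := AB i; rewrite !inE.
  by case: eqP => //= _ /implyP h /andP[iB iA]; apply: h; rewrite iB.
- case=> A As /andP[XA /forallP AX]; case jAX : (j \in A :\: X); last first.
    left; apply/hasP; exists A => //; rewrite XA /=; apply/forallP => i.
    apply/implyP => iAX; have := implyP (AX i) iAX; rewrite inE => /orP[/eqP ij|//].
    by rewrite ij jAX in iAX.
  right; move: jAX; rewrite inE => /andP[jX jA]; apply/mapP; exists (j |: X).
    rewrite IH; apply/hasP; exists A => //.
    rewrite finset.subUset finset.sub1set jA XA /=; apply/forallP => i; apply/implyP.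
    have := AX i; rewrite !inE negb_or -andbA => /implyP h /and3P[ij iX iA].
    by have := h; rewrite iX iA (negPf ij) => /(_ isT).
  by rewrite finset.setU1K.
Qed.

Lemma close_rows_uniq s : uniq s -> uniq (close_rows s).
Proof. exact: uniq_foldr_stage. Qed.

Lemma mem_close_rows s F : s =i F -> close_rows s =i downset F.
Proof.
move=> sF X; rewrite mem_foldr_stage inE; apply/hasP/existsP.
  by case=> A As /andP[XA _]; exists A; rewrite -sF As.
case=> A /andP[AF XA]; exists A; rewrite ?sF // XA /=.
by apply/forallP => i; rewrite mem_enum implybT.
Qed.

(** The intermediate lists stay inside the downset, whose size therefore bounds the memory and the
    loop counters of the whole run. *)
Lemma foldr_stage_down s F js : s =i F -> {subset foldr stage s js <= downset F}.
Proof.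
move=> sF X; rewrite mem_foldr_stage inE => /hasP[A As /andP[XA _]].
by apply/existsP; exists A; rewrite -sF As.
Qed.

Lemma foldr_add_row_down j t F s :
  {subset t <= downset F} -> {subset s <= downset F} ->
  {subset foldr (fun (A : {set 'I_n}) u => add_row u (A :\ j)) t s <= downset F}.
Proof.
move=> tF sF X; rewrite mem_foldr_add_row => /orP[/tF//|/mapP[A /sF AF ->]].
move: AF; rewrite !inE => /existsP[B /andP[BF AB]]; apply/existsP; exists B.
by rewrite BF (fintype.subset_trans (subD1set _ _) AB).
Qed.

Lemma card_downset p F :
  (forall A, A \in F -> #|A| <= p) -> #|downset F| <= #|F| * 2 ^ p.
Proof.
move=> Fp; have -> : downset F = \bigcup_(A in F) powerset A.
  apply/setP => X; rewrite inE; apply/existsP/finset.bigcupP.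
    by case=> A /andP[AF XA]; exists A => //; rewrite inE.
  by case=> A AF; rewrite inE => XA; exists A; rewrite AF.
rewrite -sum_nat_const; elim/big_ind2: _ => [|X a Y b Xa Yb|A AF].
- by rewrite cards0.
- exact: leq_trans (leq_card_setU _ _) (leq_add Xa Yb).
- by rewrite card_powerset leq_exp2l // Fp.
Qed.

Lemma downset_le p F : (forall A, A \in F -> #|A| <= p) ->
  forall A, A \in downset F -> #|A| <= p.
Proof.
move=> Fp A; rewrite inE => /existsP[B /andP[BF AB]].
exact: leq_trans (subset_leq_card AB) (Fp _ BF).
Qed.

End Closure.

(** * Covers, partitions and their refinement *)

Section Partitions.

Variable n : nat.
Implicit Types (C F P : {set {set 'I_n}}).

(** Choose for each element [i] a set [f i] of the cover that contains it. The nonempty fibres of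
    [f] are the parts; the fibre over [A] lies in [A], and there are at most as many fibres as sets
    in [C]. *)
Lemma partition_of_cover C : finset.cover C = [set: 'I_n]%SET ->
  exists P, [/\ finset.partition P [set: 'I_n]%SET, P \subset downset C & #|P| <= #|C|].
Proof.
move=> coverC; have memC i : exists A, (A \in C) && (i \in A).
  have : i \in finset.cover C by rewrite coverC inE.
  by case/finset.bigcupP=> A CA iA; exists A; rewrite CA.
pose f i := xchoose (memC i).
have fP i : (f i \in C) && (i \in f i) by exact: (xchooseP (memC i)).
pose P := preim_partition f [set: 'I_n]%SET; exists P; split.
- exact: preim_partitionP.
- apply/fintype.subsetP => _ /finset.imsetP[i _ ->]; rewrite inE.
  apply/existsP; exists (f i); case/andP: (fP i) => -> _ /=.
  apply/fintype.subsetP => j; rewrite !inE /= => /eqP ->.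
  by case/andP: (fP j).
- pose g A := [set j in [set: 'I_n]%SET | A == f j]%SET.
  have /subset_leq_card/leq_trans : P \subset g @: C; last by apply; exact: leq_imset_card.
  apply/fintype.subsetP => _ /finset.imsetP[i _ ->]; apply/finset.imsetP.
  by exists (f i) => //; case/andP: (fP i).
Qed.

(** With fewer than [n] parts, some part [A] has at least two elements. Splitting it into a
    singleton and the rest stays in [F], which is closed under subsets. *)
Lemma split_part P F : downset F \subset F -> P \subset F ->
  finset.partition P [set: 'I_n]%SET -> #|P| < n ->
  exists P', [/\ finset.partition P' [set: 'I_n]%SET, P' \subset F & #|P'| = #|P|.+1].
Proof.
move=> downF PF partP ltPn; have /and3P[/eqP coverP trivP P0] := partP.
have [A AP A2] : exists2 A, A \in P & 1 < #|A|.
  case: (boolP [exists A in P, 1 < #|A|]) => [/existsP[A /andP[AP A2]]|].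
    by exists A.
  rewrite negb_exists => /forallP le1; exfalso; move: ltPn.
  rewrite ltnNge -{1}(card_ord n) -cardsT (card_partition partP) -sum1_card.
  case/negP; apply: leq_sum => A AP.
  by move: (le1 A); rewrite AP /= -leqNgt.
have [i iA] : exists i, i \in A by apply/card_gt0P; apply: ltn_trans A2.
have iB : [set i] \in F.
  apply: (fintype.subsetP downF); rewrite inE; apply/existsP; exists A.
  by rewrite (fintype.subsetP PF) //= finset.sub1set.
have AiF : A :\ i \in F.
  apply: (fintype.subsetP downF); rewrite inE; apply/existsP; exists A.
  by rewrite (fintype.subsetP PF) //= finset.subsetDl.
have Ai0 : A :\ i != finset.set0.
  by rewrite -card_gt0; move: A2; rewrite (cardsD1 i) iA.
pose P' := ([set i] |: ((A :\ i) |: (P :\ A)))%SET.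
(* A nonempty subset of [A] meets [A], so it is none of the other parts; hence the new pieces count
   as additional parts. *)
have notin B : B != finset.set0 -> B \subset A -> B \notin P :\ A.
  move=> B0 BA; apply/negP; rewrite !inE => /andP[BnA BP].
  have /finset.trivIsetP/(_ _ _ BP AP BnA) := trivP.
  by rewrite -setI_eq0 (finset.setIidPl BA) (negPf B0).
have iP : [set i] \notin (A :\ i) |: (P :\ A).
  rewrite in_setU1 negb_or notin ?finset.sub1set ?andbT //; last first.
    by rewrite -card_gt0 cards1.
  apply/eqP => /finset.setP/(_ i); by rewrite !inE eqxx.
exists P'; split.
- apply/and3P; split.
  + rewrite finset.eqEsubset finset.subsetT /=; apply/fintype.subsetP => j _.
    have : j \in finset.cover P by rewrite coverP inE.
    case/finset.bigcupP=> B BP jB; apply/finset.bigcupP.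
    have [EB|BA] := eqVneq B A; last by exists B; rewrite // !inE BP BA !orbT.
    have [->|ji] := eqVneq j i; first by exists [set i]; rewrite !inE eqxx.
    by exists (A :\ i); rewrite !inE ?eqxx ?orbT // ji -EB.
  + have tr1 : finset.trivIset (P :\ A) by apply: finset.trivIsetS trivP; exact: finset.subsetDl.
    have dis (X : {set 'I_n}) : X \subset A -> {in P :\ A, forall B : {set 'I_n}, [disjoint X & B]}.
      move=> XA B /finset.setD1P[BA BP].
      apply: fintype.disjointWl XA _.
      by have /finset.trivIsetP/(_ _ _ AP BP) := trivP; apply; rewrite eq_sym.
    have P10 : finset.set0 \notin P :\ A by rewrite inE negb_and P0 orbT.
    have [tr2 _] := finset.trivIsetU1 (dis _ (subD1set A i)) tr1 P10.
    apply: (finset.trivIsetU1 _ tr2 _).1; last first.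
      by rewrite in_setU1 negb_or eq_sym Ai0.
    move=> B; rewrite in_setU1 => /orP[/eqP ->|BP].
      by rewrite disjoints1 !inE eqxx.
    by apply: dis BP; rewrite finset.sub1set.
  + rewrite !inE !negb_or (negPf P0) andbF andbT eq_sym.
    by rewrite -card_gt0 cards1 eq_sym.
- by rewrite !finset.subUset !finset.sub1set iB AiF (fintype.subset_trans (subD1set _ _)).
- by rewrite !cardsU1 iP notin ?finset.subsetDl // (cardsD1 A P) AP.
Qed.

End Partitions.

(** The target of the Set Partitioning instance. It is capped at [n] because a partition has at most
    [n] nonempty parts; a negative target is kept, being a no-instance of both problems. *)
Definition clip (n : nat) (t : int) : int :=
  if (t < 0)%R then t else Posz (minn `|t| n).

Lemma split_partition n (F P : {set {set 'I_n}}) d :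
  finset.partition P [set: 'I_n]%SET -> P \subset downset F -> #|P| + d <= n ->
  exists P', [/\ finset.partition P' [set: 'I_n]%SET, P' \subset downset F &
    #|P'| = #|P| + d].
Proof.
move=> partP PF; elim: d => [|d IH] le_n; first by exists P; rewrite addn0.
rewrite addnS in le_n *; have [P1 [partP1 P1F cP1]] := IH (ltnW le_n).
rewrite -cP1; apply: split_part => //; last by rewrite cP1.
apply/fintype.subsetP => A; rewrite !inE => /existsP[B /andP[]].
rewrite inE => /existsP[G /andP[GF BG]] AB; apply/existsP; exists G.
by rewrite GF (fintype.subset_trans AB).
Qed.

Lemma card_partition_le n (P : {set {set 'I_n}}) :
  finset.partition P [set: 'I_n]%SET -> #|P| <= n.
Proof.
move=> partP; have /and3P[_ _ P0] := partP.
rewrite -[X in _ <= X]card_ord -cardsT (card_partition partP) -sum1_card.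
apply: leq_sum => A AP; rewrite card_gt0.
by apply: contraNneq P0 => <-.
Qed.

Lemma cover_iff_partitioning n (F : {set {set 'I_n}}) (t : int) :
  [exists C : {set {set 'I_n}}, [&& C \subset downset F,
     (#|C|%:Z == clip n t)%R, finset.cover C == [set: 'I_n]%SET
     & finset.trivIset C]] =
  [exists C : {set {set 'I_n}}, [&& C \subset F, (#|C|%:Z <= t)%R
     & finset.cover C == [set: 'I_n]%SET]].
Proof.
apply/existsP/existsP => [[C /and4P[CF /eqP cC /eqP coverC _]]|[C /and3P[CF Ct /eqP coverC]]].
  (* Enlarge each part to a member of [F]. Several parts may get the same member, so only an upper
     bound on their number survives. The default [A] is never taken on [C]. *)
  pose g (A : {set 'I_n}) := odflt A [pick B in F | A \subset B].
  have gP A : A \in C -> g A \in F /\ A \subset g A.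
    move=> /(fintype.subsetP CF); rewrite inE => /existsP[B FB].
    by rewrite /g; case: pickP => [D /andP[//]|/(_ B)]; rewrite FB.
  exists (g @: C); apply/and3P; split.
  - by apply/fintype.subsetP => _ /finset.imsetP[A /gP[gF _] ->].
  - apply: (@le_trans _ _ #|C|%:Z%R); first by rewrite lez_nat leq_imset_card.
    rewrite cC /clip; case: ltP => // t0.
    by rewrite -[X in (_ <= X)%R](gez0_abs t0) lez_nat geq_minl.
  - rewrite finset.eqEsubset finset.subsetT -coverC; apply/fintype.subsetP => i.
    case/finset.bigcupP=> A CA iA; apply/finset.bigcupP; exists (g A).
      exact: imset_f.
    by have [_ /fintype.subsetP] := gP A CA; apply.
have [P [partP PC PleC]] := partition_of_cover coverC.
have PF : P \subset downset F.
  apply: fintype.subset_trans PC _; apply/fintype.subsetP => A.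
  rewrite !inE => /existsP[B /andP[BC AB]]; apply/existsP; exists B.
  by rewrite (fintype.subsetP CF).
have Pn := card_partition_le partP.
case: t Ct => // m; rewrite lez_nat => Cm.
(* [P] has at most [m] parts, like [C], and at most [n], so the subtraction is not truncated. *)
have [|P' [/and3P[cP tP _] P'F cP']] := @split_partition n F P (minn m n - #|P|) partP PF.
  by lia.
exists P'; rewrite P'F cP tP cP' /= andbT /clip /= subnKC // leq_min Pn andbT.
exact: leq_trans Cm.
Qed.

(** * Cost of structured programs *)

(** Total correctness with cost, for runs that leave the coins intact: one cost and one final state
    serve for all [r], which is the form that composition with a randomized program requires. *)
Definition wp (P : prog) (st : state) (Q : nat -> state -> Prop) : Prop :=
  exists k st', (forall r, exec P st r k st' r) /\ Q k st'.

Lemma bitlen_le v : bitlen v <= v.+1.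
Proof.
rewrite /bitlen ltnS; case: v => [|v]; first by rewrite trunc_log0.
by apply: leq_trans (ltnW (ltn_expl _ (ltnSn 1))) (trunc_logP _ _).
Qed.

Lemma leq_bitlen u v : u <= v -> bitlen u <= bitlen v.
Proof. by move=> uv; rewrite /bitlen ltnS leq_trunc_log. Qed.

Lemma bitlen_bool (b : bool) : bitlen b = 1.
Proof. by case: b; rewrite /bitlen ?trunc_log0 ?trunc_log1. Qed.

Lemma wp_weaken P st (Q Q' : nat -> state -> Prop) :
  wp P st Q -> (forall k st', Q k st' -> Q' k st') -> wp P st Q'.
Proof. by move=> [k [st' [E q]]] QQ'; exists k, st'; split=> //; exact: QQ'. Qed.

Lemma wp_skip st Q : Q 1 st -> wp Skip st Q.
Proof. by move=> q; exists 1, st; split=> // r; constructor. Qed.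

Lemma wp_const x c st Q : Q (bitlen c) (set_reg st x c) -> wp (Const x c) st Q.
Proof. by move=> q; do 2 eexists; split; [move=> r; constructor|]. Qed.

Lemma wp_plus x y z st Q :
  Q (bitlen (reg st y) + bitlen (reg st z)) (set_reg st x (reg st y + reg st z)) ->
  wp (Plus x y z) st Q.
Proof. by move=> q; do 2 eexists; split; [move=> r; constructor|]. Qed.

Lemma wp_minus x y z st Q :
  Q (bitlen (reg st y) + bitlen (reg st z)) (set_reg st x (reg st y - reg st z)) ->
  wp (Minus x y z) st Q.
Proof. by move=> q; do 2 eexists; split; [move=> r; constructor|]. Qed.

Lemma wp_read x y st Q :
  Q (bitlen (reg st y) + bitlen (ram st (reg st y)))
    (set_reg st x (ram st (reg st y))) ->
  wp (Read x y) st Q.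
Proof. by move=> q; do 2 eexists; split; [move=> r; constructor|]. Qed.

Lemma wp_write x y st Q :
  Q (bitlen (reg st x) + bitlen (reg st y)) (set_ram st (reg st x) (reg st y)) ->
  wp (Write x y) st Q.
Proof. by move=> q; do 2 eexists; split; [move=> r; constructor|]. Qed.

Lemma wp_seq P P' st Q :
  wp P st (fun k1 st1 => wp P' st1 (fun k2 => Q (k1 + k2))) ->
  wp (Seq P P') st Q.
Proof.
move=> [k1 [st1 [E1 [k2 [st2 [E2 q]]]]]]; exists (k1 + k2), st2; split=> // r.
exact: ExecSeq.
Qed.

Lemma wp_if x P P' st Q :
  (reg st x != 0 -> wp P st (fun k => Q (bitlen (reg st x) + k))) ->
  (reg st x = 0 -> wp P' st (fun k => Q (bitlen (reg st x) + k))) ->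
  wp (If x P P') st Q.
Proof.
move=> PQ PQ'; have [x0|x0] := eqVneq (reg st x) 0.
  have [k [st' [E q]]] := PQ' x0; do 2 eexists; split; last exact: q.
  by move=> r; apply: ExecIfFalse.
have [k [st' [E q]]] := PQ x0; do 2 eexists; split; last exact: q.
by move=> r; apply: ExecIfTrue.
Qed.

(** Bounds an action on two operands that are at most [b + 1], since [bitlen v <= v + 1]. *)
Definition step b := b.*2 + 4.
(** At most [b] rounds, each paying for the body, the test and the decrement; the final test of 0
    costs 1. *)
Definition loop b k := (b * (k + b.*2 + 4)).+1.

(* Throughout, register 0 is never written and register 1 holds the constant 1. *)
Definition For (x : nat) (P : prog) : prog := While x (Seq (Minus x x 1) P).

(** The invariant is indexed by the rounds left. The body starts after the decrement, so it sees the
    counter at [c] and handles index [c]; the indices run from [N - 1] down to 0. *)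
Lemma wp_for x P (Inv : nat -> state -> Prop) b K N st :
  (forall c st, Inv c st -> reg st x = c /\ reg st 1 = 1) ->
  (forall c st, c < N -> Inv c.+1 st ->
     wp P (set_reg st x c) (fun k st' => k <= K /\ Inv c st')) ->
  N <= b -> Inv N st ->
  wp (For x P) st (fun k st' => k <= loop b K /\ Inv 0 st').
Proof.
move=> Ireg IP Nb; suff H c st' : c <= N -> Inv c st' -> wp (For x P) st'
    (fun k st' => k <= (c * (K + b.*2 + 4)).+1 /\ Inv 0 st').
  move=> /H [] // k [st' [E [kle i0]]]; exists k, st'; do !split=> //.
  by apply: leq_trans kle _; rewrite ltnS leq_mul2r Nb orbT.
elim: c st' => [|c IH] st' cN Ic; have [rx r1] := Ireg _ _ Ic.
  exists (bitlen (reg st' x)), st'; split; first by move=> r; constructor.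
  by rewrite rx mul0n /bitlen trunc_log0.
have [k [st1 [E1 [kK I1]]]] := IP _ _ cN Ic.
have [k' [st2 [E2 [k'K I2]]]] := IH _ (ltnW cN) I1.
exists (bitlen (reg st' x) + (bitlen (reg st' x) + bitlen (reg st' 1) + k) + k').
exists st2; split=> [r|].
  apply: ExecWhileTrue (E2 r); first by rewrite rx.
  apply: ExecSeq (E1 r); have -> : c = reg st' x - reg st' 1 by rewrite rx r1; lia.
  by constructor.
by split=> //; have := bitlen_le c.+1; have := bitlen_le 1; rewrite rx r1 mulSn; lia.
Qed.

(* The program uses registers up to 15, numbered so that inner loops clobber a
   final segment. *)
Definition keeps (a b : nat) (st st' : state) : Prop :=
  forall y, (a <= y < b) || (15 < y) -> reg st' y = reg st y.

Lemma keeps_trans a b c d st st1 st2 : a <= c -> d <= b ->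
  keeps a b st st1 -> keeps c d st1 st2 -> keeps c d st st2.
Proof. by move=> ac db K1 K2 y yd; rewrite K2 ?K1 //; lia. Qed.

Lemma keeps_set_reg a b st st' x v : b <= x <= 15 ->
  keeps a b st st' -> keeps a b st (set_reg st' x v).
Proof.
by move=> bx K y ya; rewrite -K // /set_reg /= /upd; case: eqP => // yx; lia.
Qed.

Lemma keeps_set_ram a b st st' x v :
  keeps a b st st' -> keeps a b st (set_ram st' x v).
Proof. by []. Qed.

(** * Memory layout of a family *)

Section Layout.

Variables (n : nat) (h : seq nat).
Implicit Types (s : seq {set 'I_n}) (F : nat -> {set 'I_n}).

(** Four header cells, then row [k] of [n] cells for the set [F k]. The existential turns an address
    into an element without a bound to prove, and gives 0 when [n] is 0. *)
Definition cells F (a : nat) : nat :=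
  if a < 4 then nth 0 h a
  else [exists l : 'I_n, (l == (a - 4) %% n :> nat) && (l \in F ((a - 4) %/ n))].

Definition layout s : nat -> nat := cells (nth finset.set0 s).

Lemma cells_row F k (l : 'I_n) : cells F (4 + k * n + l) = (l \in F k).
Proof.
rewrite /cells -addnA ltnNge leq_addr addKn /=.
rewrite modnMDl modn_small // divnMDl; last exact: leq_ltn_trans (ltn_ord l).
rewrite divn_small // addn0; congr nat_of_bool; apply/existsP/idP.
  by case=> l' /andP[/eqP/val_inj ->].
by move=> lF; exists l; rewrite eqxx.
Qed.

Lemma cells_addr a : 0 < n -> 4 <= a -> exists k (l : 'I_n), a = 4 + k * n + l.
Proof.
move=> n0 a4; exists ((a - 4) %/ n), (Ordinal (ltn_pmod (a - 4) n0)) => /=.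
by rewrite -addnA -divn_eq subnKC.
Qed.

Lemma eq_cells F F' : F =1 F' -> cells F = cells F'.
Proof.
move=> FF; apply/funext => a; rewrite /cells; case: ifP => // _.
by congr nat_of_bool; apply: eq_existsb => l; rewrite FF.
Qed.

Lemma upd_cells F k (l : 'I_n) (b : bool) :
  upd (cells F) (4 + k * n + l) b =
  cells (fun k' => if k' == k then if b then l |: F k else F k :\ l else F k').
Proof.
apply/funext => a; rewrite /upd; have [a4|a4] := ltnP a 4.
  by rewrite /cells a4; case: eqP => // ?; lia.
have n0 : 0 < n by exact: leq_ltn_trans (ltn_ord l).
have [k' [l' ->]] := cells_addr n0 a4; rewrite !cells_row.
have [->|kk] := eqVneq k' k.
  rewrite eqn_add2l; have [/val_inj ->|ll] := eqVneq (l' : nat) l.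
    by case: b; rewrite !inE eqxx.
  by case: b; rewrite !inE -(inj_eq val_inj) (negPf ll).
case: eqP => // E; case/eqP: kk; have ln := ltn_ord l; have ln' := ltn_ord l'; nia.
Qed.

Lemma layout_row s k (l : 'I_n) : layout s (4 + k * n + l) = (l \in nth finset.set0 s k).
Proof. exact: cells_row. Qed.

Lemma upd_layout s Y (l : 'I_n) (b : bool) :
  upd (layout (rcons s Y)) (4 + size s * n + l) b =
  layout (rcons s (if b then l |: Y else Y :\ l)).
Proof.
rewrite upd_cells; apply: eq_cells => k; rewrite !nth_rcons ltnn eqxx.
by case: ltngtP.
Qed.

(** Memory past the list is 0, so the row there can serve as a scratch row that holds the empty
    set. *)
Lemma layout_rcons0 s : layout (rcons s finset.set0) = layout s.
Proof.
apply: eq_cells => k; rewrite nth_rcons.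
by case: ltngtP => // [ks|->]; rewrite nth_default // ltnW.
Qed.

End Layout.

Lemma family_word_layout n (t : int) (s : seq {set 'I_n}) :
  nth 0 (family_word t s) = layout [:: n; nat_of_bool (t < 0)%R; `|t|%N; size s] s.
Proof.
apply/funext => a; rewrite /family_word nth_cat [size _]/=.
have [a4|a4] := ltnP a 4; first by rewrite /layout /cells a4.
have sz (r : seq {set 'I_n}) : size (flatten [seq char_vector A | A <- r]) = size r * n.
  by elim: r => //= A r IH; rewrite size_cat IH size_map size_enum_ord mulSn.
case: (posnP n) => [n0|n0].
  rewrite nth_default; last by rewrite sz [X in _ * X]n0 muln0.
  rewrite /layout /cells ltnNge a4 /=.
  by case: existsP => // -[l]; have := ltn_ord l; rewrite {2}n0.
have [k [l ->]] := cells_addr n0 a4; rewrite layout_row -addnA addKn.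
elim: s k {a a4} => [|A s IH] k /=; first by rewrite !nth_nil inE.
rewrite nth_cat size_map size_enum_ord; case: k => [|k] /=.
  rewrite mul0n add0n ltn_ord (nth_map l) ?size_enum_ord //.
  by rewrite nth_ord_enum.
rewrite ltnNge mulSn -addnA leq_addr /= addKn; exact: IH.
Qed.

(* [rE] is the first address after the listed sets, [rPI] and [rPK] are the
   addresses of the sets numbered [rI] and [rK]; [rF] tells whether a set was
   found and [rD] counts the differences between two sets. *)
Local Notation rN := 2 (only parsing).
Local Notation rM := 3 (only parsing).
Local Notation rE := 4 (only parsing).
Local Notation rJ := 5 (only parsing).
Local Notation rI := 6 (only parsing).
Local Notation rPI := 7 (only parsing).
Local Notation rK := 8 (only parsing).
Local Notation rPK := 9 (only parsing).
Local Notation rF := 10 (only parsing).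
Local Notation rD := 11 (only parsing).
Local Notation rL := 12 (only parsing).
Local Notation rA := 13 (only parsing).
Local Notation rV := 14 (only parsing).
Local Notation rW := 15 (only parsing).
Local Notation "P ;; Q" := (Seq P Q) (at level 61, right associativity).

(** * The closure program *)

(** The operand [0] of [Plus] and [Write] names register 0, whose value is 0: [Plus x y 0] is a
    move. The copy goes to the scratch row at [rE]. *)
Definition copy_row : prog :=
  Plus rL rN 0 ;;
  For rL (Plus rA rPI rL ;; Read rV rA ;; Plus rA rE rL ;; Write rA rV).

Definition clear_row : prog :=
  Plus rL rN 0 ;; For rL (Plus rA rE rL ;; Write rA 0).

(** Subtraction is truncated, so the two differences of a pair of 0-1 cells add up to 1 if the cells
    differ and to 0 otherwise. *)
Definition diff_row : prog :=
  Const rD 0 ;; Plus rL rN 0 ;;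
  For rL (Plus rA rPK rL ;; Read rV rA ;; Plus rA rE rL ;; Read rW rA ;;
          Minus rA rV rW ;; Plus rD rD rA ;; Minus rA rW rV ;; Plus rD rD rA).

Definition search : prog :=
  Const rF 0 ;; Plus rK rM 0 ;; Plus rPK rE 0 ;;
  For rK (Minus rPK rPK rN ;; diff_row ;; If rD Skip (Const rF 1)).

(** The candidate is built in the scratch row. If it is new, advancing [rM] and [rE] makes it part
    of the list; if not, the row is cleared so that memory past the list is 0 again. *)
Definition delete : prog :=
  copy_row ;; Plus rA rE rJ ;; Write rA 0 ;; search ;;
  If rF clear_row (Plus rM rM 1 ;; Plus rE rE rN).

(** The machine has no multiplication, so the address [rPI] is moved along with the counter [rI].
    Both start from the end of the list as it is before the stage. *)
Definition stage_prog : prog :=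
  Plus rI rM 0 ;; Plus rPI rE 0 ;; For rI (Minus rPI rPI rN ;; delete).

Definition closure_prog : prog := Plus rJ rN 0 ;; For rJ stage_prog.

Local Arguments upd f i v j /.
Local Arguments For : simpl never.

(** Replaces every [bitlen v] by a variable bounded by [v + 1], which makes cost goals linear. *)
Ltac charge :=
  repeat match goal with |- context [bitlen ?v] =>
    let H := fresh "cost" in have := bitlen_le v; move: (bitlen v) => ? H
  end.

Ltac cost :=
  charge;
  match goal with |- context [step ?x] => have : step x = x.*2 + 4 by [] end;
  lia.

Definition copy_cost b := step b + loop b (4 * step b).
Definition clear_cost b := step b + loop b (2 * step b).
Definition diff_cost b := 2 * step b + loop b (8 * step b).
Definition search_cost b := 3 * step b + loop b (3 * step b + diff_cost b).
Definition delete_cost b :=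
  5 * step b + copy_cost b + search_cost b + clear_cost b.
Definition stage_cost b := 2 * step b + loop b (step b + delete_cost b).
Definition closure_cost b := step b + loop b (stage_cost b).

(** * Correctness and cost of the closure program *)

Section Spec.

Variables (n : nat) (h : seq nat) (b : nat).
Implicit Types (s : seq {set 'I_n}) (st : state).

(** What the registers say about the stored list [s]. Memory is left out because the scratch row
    varies. *)
Record ready s st : Prop := Ready {
  ready0 : reg st 0 = 0;
  ready1 : reg st 1 = 1;
  readyN : reg st rN = n;
  readyM : reg st rM = size s;
  readyE : reg st rE = 4 + size s * n }.

Lemma ready_keeps s st st' c : 5 <= c ->
  ready s st -> keeps 0 c st st' -> ready s st'.
Proof. by move=> c5 [r0 r1 rn rm re] K; split; rewrite K //; lia. Qed.

Lemma copy_row_wp s st Y i :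
  4 + (size s).+1 * n <= b -> ready s st -> i < size s ->
  reg st rPI = 4 + i * n -> ram st = layout h (rcons s Y) ->
  wp copy_row st (fun k st' => [/\ k <= copy_cost b, keeps 0 11 st st' &
    ram st' = layout h (rcons s (nth finset.set0 s i))]).
Proof.
move=> sb R is_ PI mst; have [r0 r1 rn rm re] := R.
set X := nth _ s i; apply/wp_seq/wp_plus; rewrite r0 rn addn0.
(* The loop counts down, so the cells from [c] on are already copied; [Z] is the scratch row so
   far. *)
pose Inv c st' := [/\ reg st' rL = c, keeps 0 11 st st' & exists2 Z,
  ram st' = layout h (rcons s Z) & forall l : 'I_n, c <= l -> (l \in Z) = (l \in X)].
have nb : n <= b by lia.
have Inv_n : Inv n (set_reg st rL n).
  split=> //; first exact: keeps_set_reg.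
  by exists Y => // l; rewrite leqNgt ltn_ord.
apply: wp_weaken (wp_for (K := 4 * step b) _ _ nb Inv_n) _ => [c st' [rc Ks _]|c st' cn|].
- by rewrite rc (Ks 1) // r1.
- case=> rc Ks [Z mZ ZX].
  have [q0 q1 qn qm qe] := ready_keeps (c := 11) isT R Ks.
  have qPI : reg st' rPI = 4 + i * n by rewrite Ks.
  pose l := Ordinal cn.
  have rowi : ram st' (4 + i * n + c) = (l \in X).
    by rewrite mZ -[c]/(val l) layout_row nth_rcons is_.
  apply/wp_seq/wp_plus; rewrite /= qPI; apply/wp_seq/wp_read; rewrite /= rowi.
  apply/wp_seq/wp_plus; rewrite /= qe; apply/wp_write; rewrite /=.
  split; last split.
  + have : i.+1 * n <= size s * n by rewrite leq_mul2r is_ orbT.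
    by cost.
  + by [].
  + by apply: keeps_set_ram; do !apply: keeps_set_reg.
  + rewrite /= mZ (upd_layout h s Z l); eexists; first by [].
    move=> l' cl'; have [->|l'l] := eqVneq l' l; first by case: ifP => lX; rewrite !inE eqxx.
    have {}cl' : c < l' by move: l'l cl'; rewrite -(inj_eq val_inj) /=; lia.
    by rewrite -(ZX _ cl'); case: ifP => _; rewrite !inE (negPf l'l).
- move=> k st' [kK [_ Ks [Z mZ ZX]]]; split=> //.
    by rewrite /copy_cost; cost.
  by rewrite mZ; congr (layout h (rcons s _)); apply/finset.setP => l; rewrite ZX.
Qed.


Lemma clear_row_wp s st Y :
  4 + (size s).+1 * n <= b -> ready s st -> ram st = layout h (rcons s Y) ->
  wp clear_row st (fun k st' => [/\ k <= clear_cost b, keeps 0 11 st st' &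
    ram st' = layout h s]).
Proof.
move=> sb R mst; have [r0 r1 rn rm re] := R.
apply/wp_seq/wp_plus; rewrite r0 rn addn0.
pose Inv c st' := [/\ reg st' rL = c, keeps 0 11 st st' & exists2 Z,
  ram st' = layout h (rcons s Z) & forall l : 'I_n, c <= l -> l \notin Z].
have nb : n <= b by lia.
have Inv_n : Inv n (set_reg st rL n).
  split=> //; first exact: keeps_set_reg.
  by exists Y => // l; rewrite leqNgt ltn_ord.
apply: wp_weaken (wp_for (K := 2 * step b) _ _ nb Inv_n) _ => [c st' [rc Ks _]|c st' cn|].
- by rewrite rc (Ks 1) // r1.
- case=> rc Ks [Z mZ Z0].
  have [q0 q1 qn qm qe] := ready_keeps (c := 11) isT R Ks.
  pose l := Ordinal cn.
  apply/wp_seq/wp_plus; rewrite /= qe; apply/wp_write; rewrite /= q0.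
  split; last split.
  + by cost.
  + by [].
  + by apply: keeps_set_ram; do !apply: keeps_set_reg.
  + rewrite /= mZ (upd_layout h s Z l false); eexists; first by [].
    move=> l' cl'; rewrite !inE; have [//|l'l] := eqVneq l' l.
    by apply: Z0; move: l'l cl'; rewrite -(inj_eq val_inj) /=; lia.
- move=> k st' [kK [_ Ks [Z mZ Z0]]]; split=> //.
    by rewrite /clear_cost; cost.
  suff -> : ram st' = layout h (rcons s finset.set0) by rewrite layout_rcons0.
  rewrite mZ; congr (layout h (rcons s _)); apply/finset.setP => l.
  by rewrite inE (negPf (Z0 l _)).
Qed.

Lemma diff_row_wp s st X k :
  4 + (size s).+1 * n <= b -> ready s st -> k < size s ->
  reg st rPK = 4 + k * n -> ram st = layout h (rcons s X) ->
  wp diff_row st (fun c st' => [/\ c <= diff_cost b, keeps 0 11 st st',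
    ram st' = ram st, reg st' rD <= b &
    (reg st' rD == 0) = (nth finset.set0 s k == X)]).
Proof.
move=> sb R ks PK mst; have [r0 r1 rn rm re] := R.
set A := nth _ s k.
apply/wp_seq/wp_const/wp_seq/wp_plus; rewrite /= r0 rn addn0.
(* [rD] grows by at most 1 per cell; [rD + c <= n] keeps it below [b], as the cost of the additions
   requires. *)
pose Inv c st' := [/\ reg st' rL = c, keeps 0 11 st st', ram st' = ram st,
  reg st' rD + c <= n &
  reg st' rD = 0 <-> forall l : 'I_n, c <= l -> (l \in A) = (l \in X)].
have nb : n <= b by lia.
have Inv_n : Inv n (set_reg (set_reg st rD 0) rL n).
  split=> //; first by do !apply: keeps_set_reg.
  by split=> // _ l; rewrite leqNgt ltn_ord.
apply: wp_weaken (wp_for (K := 8 * step b) _ _ nb Inv_n) _ => [c st' [rc Ks _]|c st' cn|].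
- by rewrite rc (Ks 1) // r1.
- case=> rc Ks mst' Dn DAX.
  have [q0 q1 qn qm qe] := ready_keeps (c := 11) isT R Ks.
  have qPK : reg st' rPK = 4 + k * n by rewrite Ks.
  pose l := Ordinal cn.
  have rowk : ram st' (4 + k * n + c) = (l \in A).
    by rewrite mst' mst -[c]/(val l) layout_row nth_rcons ks.
  have rowX : ram st' (4 + size s * n + c) = (l \in X).
    by rewrite mst' mst -[c]/(val l) layout_row nth_rcons ltnn eqxx.
  apply/wp_seq/wp_plus; rewrite /= qPK; apply/wp_seq/wp_read; rewrite /= rowk.
  apply/wp_seq/wp_plus; rewrite /= qe; apply/wp_seq/wp_read; rewrite /= rowX.
  apply/wp_seq/wp_minus/wp_seq/wp_plus/wp_seq/wp_minus/wp_plus; rewrite /=.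
  split; last split.
  + have : k.+1 * n <= size s * n by rewrite leq_mul2r ks orbT.
    by cost.
  + by [].
  + by do !apply: keeps_set_reg.
  + by [].
  + by rewrite /=; lia.
  + rewrite /=; split=> [D0 l' cl'|AX].
      have [->|l'l] := eqVneq l' l; first by lia.
      apply: DAX.1; first by lia.
      by move: l'l cl'; rewrite -(inj_eq val_inj) /=; lia.
    by rewrite (AX l (leqnn c)) subnn !addn0; apply/DAX => l' /ltnW/AX.
- move=> c st' [cK [_ Ks mst' Dn DAX]]; split=> //.
  + by rewrite /diff_cost; cost.
  + by lia.
  + apply/eqP/eqP => [/DAX AX|AX]; first by apply/finset.setP => l; exact: AX.
    by apply/DAX => l _; rewrite AX.
Qed.

Lemma search_wp s st X :
  4 + (size s).+1 * n <= b -> size s <= b -> ready s st -> ram st = layout h (rcons s X) ->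
  wp search st (fun c st' => [/\ c <= search_cost b, keeps 0 8 st st',
    ram st' = ram st, reg st' rF <= 1 & (reg st' rF != 0) = (X \in s)]).
Proof.
move=> sb s_b R mst; have [r0 r1 rn rm re] := R.
apply/wp_seq/wp_const/wp_seq/wp_plus/wp_seq/wp_plus; rewrite /= r0 rm re !addn0.
pose Inv c st' := [/\ reg st' rK = c, reg st' rPK = 4 + c * n, keeps 0 8 st st',
  ram st' = ram st & reg st' rF = (X \in drop c s)].
have Inv_s : Inv (size s) (set_reg (set_reg (set_reg st rF 0) rK (size s)) rPK (4 + size s * n)).
  by split=> //; [do !apply: keeps_set_reg|rewrite drop_size].
apply: wp_weaken (wp_for (K := 3 * step b + diff_cost b) _ _ s_b Inv_s) _
  => [c st' [rc _ Ks _]|c st' cs|].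
- by rewrite rc (Ks 1) // r1.
- case=> rc pkE Ks mst' flE.
  have [q0 q1 qn qm qe] := ready_keeps (c := 8) isT R Ks.
  apply/wp_seq/wp_minus; rewrite /= pkE qn.
  have -> : 4 + c.+1 * n - n = 4 + c * n by lia.
  set st1 := set_reg _ _ _; apply: wp_seq.
  have Ks1 : keeps 0 8 st st1 by do !apply: keeps_set_reg.
  have R1 := ready_keeps (c := 8) isT R Ks1.
  have mst1 : ram st1 = layout h (rcons s X) by rewrite -mst.
  apply: wp_weaken (diff_row_wp sb R1 cs _ mst1) _; first by [].
  move=> k st2 [kK Ks2 mst2 D2 Deq].
  have Ks12 : keeps 0 8 st st2 by apply: keeps_trans Ks1 _ => //  y yd; apply: Ks2; lia.
  have : c.+1 * n <= size s * n by rewrite leq_mul2r cs orbT.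
  have F2 : reg st2 rF = (X \in drop c.+1 s) by rewrite Ks2.
  have FE : (X \in drop c s) = (reg st2 rD == 0) || (X \in drop c.+1 s).
    by rewrite (drop_nth finset.set0) // inE Deq eq_sym.
  move=> cns; apply: wp_if => D0.
    apply: wp_skip; split; last split=> //.
    + by cost.
    + by rewrite Ks2.
    + by rewrite Ks2.
    + by rewrite mst2.
    + by rewrite F2 FE (negPf D0).
  apply: wp_const; split; last split=> //.
  + by cost.
  + by rewrite /= Ks2.
  + by rewrite /= Ks2.
  + by do !apply: keeps_set_reg.
  + by rewrite /= mst2.
  + by rewrite FE D0 eqxx.
- move=> c st' [cK [_ _ Ks mst' flE]]; rewrite drop0 in flE; split=> //.
  + by rewrite /search_cost; cost.
  + by rewrite flE; case: (_ \in _).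
  + by rewrite flE; case: (_ \in _).
Qed.

Lemma delete_wp s st i (j : 'I_n) :
  4 + (size s).+1 * n <= b -> size s <= b -> ready s st -> i < size s ->
  reg st rJ = j -> reg st rPI = 4 + i * n -> ram st = layout h s ->
  let s' := add_row s (nth finset.set0 s i :\ j) in
  wp delete st (fun c st' => [/\ c <= delete_cost b, keeps 5 8 st st',
    ready s' st' & ram st' = layout h s']).
Proof.
move=> sb s_b R is_ Jj PI mst s'; set X := nth _ s i in s' *.
apply: wp_seq; rewrite -layout_rcons0 in mst.
apply: wp_weaken (copy_row_wp sb R is_ PI mst) _ => k1 st1 [kK1 Ks1 mst1].
have R1 := ready_keeps (c := 11) isT R Ks1; have [r0 r1 rn rm re] := R1.
apply/wp_seq/wp_plus/wp_seq/wp_write; rewrite /= re r0 (Ks1 rJ) // Jj.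
set st2 := set_ram _ _ _; apply: wp_seq.
have Ks2 : keeps 0 11 st1 st2 by apply: keeps_set_ram; exact: keeps_set_reg.
have R2 := ready_keeps (c := 11) isT R1 Ks2.
have mst2 : ram st2 = layout h (rcons s (X :\ j)).
  by rewrite /= mst1 (upd_layout h s X j false).
apply: wp_weaken (search_wp sb s_b R2 mst2) _ => k3 st3 [kK3 Ks3 mst3 F1 Fs].
have R3 := ready_keeps (c := 8) isT R2 Ks3; have [q0 q1 qn qm qe] := R3.
have K3 : keeps 5 8 st st3.
  move=> y yd; rewrite Ks3; last by lia.
  by rewrite Ks2 ?Ks1 //; lia.
have jn := ltn_ord j.
apply: wp_if => F0.
- have -> : s' = s by rewrite /s' /add_row -Fs F0.
  rewrite mst2 in mst3.
  apply: wp_weaken (clear_row_wp sb R3 mst3) _ => k4 st4 [kK4 Ks4 mst4].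
  split=> //.
  + by rewrite /delete_cost; cost.
  + by move=> y yd; rewrite Ks4 ?K3 //; lia.
  + exact: (ready_keeps (c := 11) isT R3 Ks4).
- have -> : s' = rcons s (X :\ j) by rewrite /s' /add_row -Fs F0.
  apply/wp_seq/wp_plus/wp_plus; rewrite /= qm q1 qe qn; split=> //.
  + by rewrite /delete_cost; cost.
  + move=> y yd; rewrite -K3 //=.
    by case: eqP => [?|_]; [lia|case: eqP => [?|_]; [lia|]].
  + split; rewrite //= size_rcons; lia.
  + by rewrite /= mst3.
Qed.

Variable F : {set {set 'I_n}}.
(** One bound for the whole run: the header, the longest possible list and the scratch row. *)
Hypothesis b_ge : 4 + (#|downset F|).+1 * n + #|downset F| <= b.

Lemma size_le_down s : uniq s -> {subset s <= downset F} -> size s <= #|downset F|.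
Proof. by move=> us sF; rewrite cardE uniq_leq_size // => A /sF; rewrite mem_enum. Qed.

Lemma size_bounds s : uniq s -> {subset s <= downset F} ->
  4 + (size s).+1 * n <= b /\ size s <= b.
Proof.
move=> us sF; have := size_le_down us sF => sd.
have : size s * n <= #|downset F| * n by rewrite leq_mul2r sd orbT.
by lia.
Qed.

Lemma stage_wp s st (j : 'I_n) :
  uniq s -> {subset s <= downset F} -> ready s st -> reg st rJ = j ->
  ram st = layout h s ->
  wp stage_prog st (fun c st' => [/\ c <= stage_cost b, keeps 5 6 st st',
    ready (stage j s) st' & ram st' = layout h (stage j s)]).
Proof.
move=> us sF R Jj mst; have [r0 r1 rn rm re] := R.
have [sb s_b] := size_bounds us sF.
(* The stored list when the sets numbered [c] and above have been treated. *)
pose part c := foldr (fun (A : {set 'I_n}) u => add_row u (A :\ j)) s (drop c s).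
apply/wp_seq/wp_plus/wp_seq/wp_plus; rewrite /= r0 rm re !addn0.
pose Inv c st' := [/\ reg st' rI = c /\ reg st' rPI = 4 + c * n, keeps 5 6 st st',
  ready (part c) st' & ram st' = layout h (part c)].
have Inv_s : Inv (size s) (set_reg (set_reg st rI (size s)) rPI (4 + size s * n)).
  rewrite /Inv /part drop_size; split=> //; first by do !apply: keeps_set_reg.
apply: wp_weaken (wp_for (K := step b + delete_cost b) _ _ s_b Inv_s) _
  => [c st' [[rc _] _ R' _]|c st' cs|].
- by split=> //; exact: ready1 R'.
- case=> [[rc pi] Ks R' mst']; have [q0 q1 qn qm qe] := R'.
  have prefix_part : prefix s (part c.+1) by exact: prefix_foldr_add_row.
  (* The program reads set [c] in the current, possibly longer list, of which [s] is still a
     prefix. *)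
  have partE : part c = add_row (part c.+1) (nth finset.set0 (part c.+1) c :\ j).
    rewrite {1}/part (drop_nth finset.set0 cs) /= -/(part c.+1); congr (add_row _ (_ :\ _)).
    by have /prefixP[u ->] := prefix_part; rewrite nth_cat cs.
  have up : uniq (part c.+1) by exact: uniq_foldr_add_row.
  have pF : {subset part c.+1 <= downset F}.
    by apply: foldr_add_row_down => // A /mem_drop; exact: sF.
  have [pb p_b] := size_bounds up pF.
  have cp : c < size (part c.+1).
    by have /prefixP[u ->] := prefix_part; rewrite size_cat ltn_addr.
  apply/wp_seq/wp_minus; rewrite /= pi qn.
  have -> : 4 + c.+1 * n - n = 4 + c * n by lia.
  set st1 := set_reg _ _ _.
  have Ks1 : keeps 5 6 st st1 by do !apply: keeps_set_reg.
  have R1 : ready (part c.+1) st1 by split.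
  have J1 : reg st1 rJ = j by rewrite Ks1.
  apply: wp_weaken (delete_wp pb p_b R1 cp J1 _ mst') _; first by [].
  rewrite -partE => k st2 [kK Ks2 R2 mst2]; split; last split=> //.
  + have : c.+1 * n <= size s * n by rewrite leq_mul2r cs orbT.
    by cost.
  + by split; rewrite Ks2.
  + by move=> y yd; rewrite Ks2 ?Ks1 //; lia.
- move=> c st' [cK [_ Ks R' mst']]; rewrite /part drop0 in R' mst'; split=> //.
  by rewrite /stage_cost; cost.
Qed.

Lemma closure_wp s st :
  uniq s -> s =i F -> ready s st -> ram st = layout h s ->
  wp closure_prog st (fun c st' => [/\ c <= closure_cost b, keeps 5 5 st st',
    ready (close_rows s) st' & ram st' = layout h (close_rows s)]).
Proof.
move=> us sF R mst; have [r0 r1 rn rm re] := R.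
pose part c := foldr (@stage n) s (drop c (enum 'I_n)).
apply/wp_seq/wp_plus; rewrite /= r0 rn !addn0.
(* The interval of [keeps 5 5] is empty: only the registers above 15 are claimed to be unchanged. *)
pose Inv c st' := [/\ reg st' rJ = c, keeps 5 5 st st',
  ready (part c) st' & ram st' = layout h (part c)].
have nb : n <= b by lia.
have Inv_n : Inv n (set_reg st rJ n).
  rewrite /Inv /part drop_oversize ?size_enum_ord //; split=> //.
  exact: keeps_set_reg.
apply: wp_weaken (wp_for (K := stage_cost b) _ _ nb Inv_n) _
  => [c st' [rc _ R' _]|c st' cn|].
- by split=> //; exact: ready1 R'.
- case=> [rc Ks R' mst']; have [q0 q1 qn qm qe] := R'.
  pose j := Ordinal cn.
  have partE : part c = stage j (part c.+1).
    rewrite /part (drop_nth j) ?size_enum_ord //=; congr stage.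
    by apply/val_inj; rewrite /= nth_enum_ord.
  have up : uniq (part c.+1) by exact: uniq_foldr_stage.
  have pF : {subset part c.+1 <= downset F} by exact: foldr_stage_down.
  set st1 := set_reg _ _ _.
  have Ks1 : keeps 5 5 st st1 by apply: keeps_set_reg.
  have R1 : ready (part c.+1) st1 by split.
  apply: wp_weaken (stage_wp (j := j) up pF R1 _ mst') _; first by [].
  rewrite -partE => k st2 [kK Ks2 R2 mst2]; split=> //; split=> //.
  + by rewrite Ks2.
  + by move=> y yd; rewrite Ks2 ?Ks1 //; lia.
- move=> c st' [cK [_ Ks R' mst']]; rewrite /part drop0 in R' mst'; split=> //.
  by rewrite /closure_cost; cost.
Qed.

End Spec.

(** * The reduction *)

(** With truncated subtraction [t - (t - n)] is the minimum of [t] and [n]. No loop is used, as both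
    numbers may be exponential in the input size. The first instruction sets up the constant of
    register 1. *)
Definition clip_prog : prog :=
  Const 1 1 ;; Read rN 0 ;; Read rV 1 ;;
  If rV Skip (Const rA 2 ;; Read rV rA ;; Minus rW rV rN ;; Minus rV rV rW ;;
              Write rA rV).

(** Resets registers so that the final state is exactly an initial state, from which the next
    program can start. *)
Definition erase (xs : seq nat) : prog := foldr (fun x P => Const x 0 ;; P) Skip xs.

(* The test of rM matters for the running time: without members the universe,
   hence a loop over its elements, may be exponential in the input size. *)
Definition reduction : prog :=
  clip_prog ;; Const rA 3 ;; Read rM rA ;;
  If rM (Const rE 4 ;; Plus rK rM 0 ;; For rK (Plus rE rE rN) ;;
         closure_prog ;; Const rA 3 ;; Write rA rM)
        Skip ;;
  erase (iota 1 15).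

(** [a] bounds the bit lengths of the header entries, [b] the addresses and counters of the loops.
    The entries themselves may be exponential in the input size. *)
Definition reduction_cost a b :=
  100 + 20 * a + 10 * step b + loop b (step b) + closure_cost b.

Lemma clip_sign n t : (clip n t < 0)%R = (t < 0)%R.
Proof. by rewrite /clip; case: ifP. Qed.

Lemma erase_wp xs st : wp (erase xs) st (fun k st' =>
  k = (size xs).+1 /\ st' = State (fun y => if y \in xs then 0 else reg st y) (ram st)).
Proof.
elim: xs st => [|x xs IH] st; first by apply: wp_skip; split; last case: st.
apply/wp_seq/wp_const; apply: wp_weaken (IH _) _ => k st' [-> ->].
rewrite /bitlen trunc_log0 add1n; split=> //; congr State; apply/funext => y.
by rewrite inE /=; case: eqP => //= _; case: ifP.
Qed.

(** * Correctness and cost of the reduction *)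

Section Spec.

Variables (n : nat) (t : int).
Implicit Types (s : seq {set 'I_n}).

Definition header (t : int) (m : nat) : seq nat := [:: n; nat_of_bool (t < 0)%R; `|t|%N; m].

Lemma upd_header h s a v : a < 4 -> upd (layout h s) a v = layout (set_nth 0 h a v) s.
Proof.
move=> a4; apply/funext => c; rewrite /= /layout /cells nth_set_nth /=.
by case: eqP => [->|_]; rewrite ?a4.
Qed.

Lemma clip_wp s a st :
  bitlen n <= a -> bitlen `|t| <= a -> (forall y, reg st y = 0) ->
  ram st = layout (header t (size s)) s ->
  wp clip_prog st (fun k st' => [/\ k <= 50 + 10 * a,
    [/\ reg st' 0 = 0, reg st' 1 = 1, reg st' rN = n & forall y, 15 < y -> reg st' y = 0] &
    ram st' = layout (header (clip n t) (size s)) s]).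
Proof.
move=> na ta r0 mst.
have b0 := bitlen_le 0; have b1 := bitlen_le 1; have b2 := bitlen_le 2.
apply/wp_seq/wp_const/wp_seq/wp_read; rewrite /= r0 mst.
apply/wp_seq/wp_read; rewrite /= mst.
have -> : layout (header t (size s)) s 0 = n by [].
have -> : layout (header t (size s)) s 1 = (t < 0)%R by [].
have bb := bitlen_bool (t < 0)%R.
apply: wp_if => /= [t0|].
  have {}t0 : (t < 0)%R by case: (t < 0)%R t0.
  apply: wp_skip; split; [by rewrite bb; lia| |by rewrite /clip t0 mst].
  by split=> //= y y15; do 3 (case: eqP => [?|_]; first by lia); rewrite r0.
move/eqP; rewrite eqb0 => /negPf t0.
apply/wp_seq/wp_const/wp_seq/wp_read; rewrite /= mst.
have -> : layout (header t (size s)) s 2 = `|t|%N by [].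
apply/wp_seq/wp_minus/wp_seq/wp_minus/wp_write; rewrite /= mst.
have d1 : bitlen (`|t| - n) <= bitlen `|t| by apply: leq_bitlen; exact: leq_subr.
have d2 : bitlen (`|t| - (`|t| - n)) <= bitlen `|t| by apply: leq_bitlen; exact: leq_subr.
split; first by lia.
  by split=> //= y y15; do 5 (case: eqP => [?|_]; first by lia); rewrite r0.
rewrite upd_header //; congr (layout _ s).
rewrite /header clip_sign /clip t0 /=; do 3 congr cons; lia.
Qed.

Variable F : {set {set 'I_n}}.

Lemma reduction_wp s a b :
  uniq s -> s =i F ->
  bitlen n <= a -> bitlen `|t| <= a -> bitlen (size s) <= a ->
  (0 < size s -> 4 + (#|downset F|).+1 * n + #|downset F| <= b) ->
  wp reduction (init (family_word t s)) (fun k st' => k <= reduction_cost a b /\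
    st' = init (family_word (clip n t) (close_rows s))).
Proof.
move=> us sF na ta ma bge.
have mst : ram (init (family_word t s)) = layout (header t (size s)) s.
  exact: family_word_layout.
apply: wp_seq; apply: wp_weaken (clip_wp na ta _ mst) _ => // k1 st1 [kK1 [r0 r1 rn rz] mst1].
apply/wp_seq/wp_const/wp_seq/wp_read; rewrite /= mst1.
have -> : layout (header (clip n t) (size s)) s 3 = size s by [].
set st2 := set_reg _ _ _; apply: wp_seq.
have b3 := bitlen_le 3; have b4 := bitlen_le 4.
pose s' := close_rows s.
(* Condition reached by both branches of the test of [rM]. Register 0 and those above 15 are still
   0; the others are erased next. *)
apply: (@wp_weaken _ _ (fun k st => [/\
    k <= a + 7 * step b + loop b (step b) + closure_cost b,
    forall y, (y == 0) || (15 < y) -> reg st y = 0 &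
    ram st = layout (header (clip n t) (size s')) s'])); last first.
  move=> k st [kK z mst']; apply: wp_weaken (erase_wp (iota 1 15) _) _ => _ _ [-> ->].
  split; first by rewrite /reduction_cost /=; lia.
  rewrite /init mst'; congr State; last by rewrite family_word_layout.
  apply/funext => y; rewrite mem_iota; case: ifP => // yr; apply: z; lia.
have z2 y : (y == 0) || (15 < y) -> reg st2 y = 0.
  case/orP=> [/eqP -> //|y15]; rewrite /=.
  by do 2 (case: eqP => [?|_]; first by lia); rewrite rz.
apply: wp_if => /= [s0|/size0nil s0]; last first.
  apply: wp_skip; split=> //; first by rewrite /step; lia.
  rewrite /= mst1 /s'; have -> : close_rows s = s; last by [].
  by rewrite s0 /close_rows; elim: (enum _) => //= j js ->.
have {}bge : 4 + (#|downset F|).+1 * n + #|downset F| <= b by apply: bge; rewrite lt0n.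
have [sb s_b] : 4 + (size s).+1 * n <= b /\ size s <= b.
  apply: (size_bounds bge us) => A As; rewrite inE; apply/existsP; exists A.
  by rewrite -sF As subxx.
apply/wp_seq/wp_const/wp_seq/wp_plus; rewrite /= r0 addn0.
set st3 := set_reg _ _ _; apply: wp_seq.
have keep3 y : y \notin [:: rA; rM; rE; rK] -> reg st3 y = reg st1 y.
  by rewrite !inE /= => /norP[/negPf -> /norP[/negPf -> /norP[/negPf -> /negPf ->]]].
(* The product [size s * n] is formed by repeated addition. *)
pose Inv c st := [/\ reg st rK = c, reg st rE = 4 + (size s - c) * n,
  reg st rM = size s /\ ram st = ram st1 &
  forall y, y \notin [:: rA; rM; rE; rK] -> reg st y = reg st1 y].
have Inv_s : Inv (size s) st3 by split=> //=; rewrite subnn.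
apply: wp_weaken (wp_for (K := step b) _ _ s_b Inv_s) _ => [c st [rc _ _ keep]|c st cs|].
- by rewrite rc keep.
- case=> rc re [rm mst'] keep; apply: wp_plus; rewrite /= re keep // rn.
  have le : (size s - c.+1) * n <= size s * n by rewrite leq_mul2r leq_subr orbT.
  split; first by cost.
  split=> //=; first by rewrite -addnA -mulSnr subnSK.
  move=> y yn; rewrite -keep //; move: yn; rewrite !inE.
  by case/norP=> _ /norP[_ /norP[/negPf -> /negPf ->]].
move=> k4 st4 [kK4 [_ re [rm mst4] keep]]; rewrite subn0 in re.
have R4 : ready s st4 by split=> //; rewrite keep.
apply: wp_seq; rewrite mst1 in mst4.
apply: wp_weaken (closure_wp bge us sF R4 mst4) _ => k5 st5 [kK5 Ks5 [q0 q1 qn qm qe] mst5].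
apply/wp_seq/wp_const/wp_write; rewrite /= qm mst5; split.
- have : size s' <= b.
    apply: (size_bounds bge _ _).2; first exact: close_rows_uniq.
    by move=> A; rewrite (mem_close_rows sF).
  move=> s'b; have := leq_bitlen s_b; have := bitlen_le (size s'); have := bitlen_le b.
  have := bitlen_le 0; have : step b = b.*2 + 4 by [].
  move: kK4 kK5 b3 b4 ma; rewrite -/s'.
  lia.
- move=> y /orP[/eqP -> //|y15]; rewrite /=; case: eqP => [?|_]; first by lia.
  rewrite Ks5 ?y15 ?orbT // keep ?rz // !inE; lia.
- by rewrite upd_header.
Qed.

End Spec.

(** * Polynomial bounds and the theorem *)

(** The universe, hence the parameter, is that of [I], so the exponential factor of the running time
    carries over. *)
Definition downset_instance p (I : bounded_family p) : bounded_family p :=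
  BoundedFamily (clip (univ I) (target I)) (downset_le (@members_le p I)).

Lemma input_size_family n (t : int) (s : seq {set 'I_n}) :
  input_size (family_word t s) =
  bitlen n + 1 + bitlen `|t| + bitlen (size s) + size s * n.
Proof.
rewrite /input_size big_cat /= !big_cons big_nil bitlen_bool addn0 !addnA; congr addn.
elim: s => [|A s IH] /=; first by rewrite big_nil.
rewrite big_cat /= IH mulSn big_map; congr addn.
rewrite (eq_bigr (fun=> 1)) ?sum1_size ?size_enum_ord // => i _; exact: bitlen_bool.
Qed.

Definition poly_bounded (f : nat -> nat) := exists q : {poly nat}, forall x, f x <= q.[x]%R.

(** The coefficients are natural numbers, so every term is monotone. *)
Lemma horner_mono (q : {poly nat}) x y : x <= y -> q.[x]%R <= q.[y]%R.
Proof.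
move=> xy; rewrite !horner_coef; apply: leq_sum => i _; apply: leq_mul => //.
by elim: (i : nat) => //= k IH; rewrite !exprS; exact: leq_mul.
Qed.

Lemma poly_bounded_const c : poly_bounded (fun=> c).
Proof. by exists (c%:P)%R => x; rewrite hornerC. Qed.

Lemma poly_bounded_id : poly_bounded id.
Proof. by exists 'X%R => x; rewrite hornerX. Qed.

Lemma poly_bounded_add f g : poly_bounded f -> poly_bounded g ->
  poly_bounded (fun x => f x + g x).
Proof.
move=> [p fp] [q gq]; exists (p + q)%R => x; rewrite hornerD; exact: leq_add.
Qed.

Lemma poly_bounded_mul f g : poly_bounded f -> poly_bounded g ->
  poly_bounded (fun x => f x * g x).
Proof.
move=> [p fp] [q gq]; exists (p * q)%R => x; rewrite hornerM; exact: leq_mul.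
Qed.

Lemma poly_bounded_horner (q : {poly nat}) f :
  poly_bounded f -> poly_bounded (fun x => q.[f x]%R).
Proof.
move=> [p fp]; exists (q \Po p)%R => x; rewrite horner_comp; exact: horner_mono.
Qed.

Lemma poly_bounded_step f : poly_bounded f -> poly_bounded (fun x => step (f x)).
Proof.
move=> fp; have [q fq] := poly_bounded_add (poly_bounded_mul fp (poly_bounded_const 2))
  (poly_bounded_const 4).
by exists q => x; rewrite /step -muln2.
Qed.

Lemma poly_bounded_loop f g : poly_bounded f -> poly_bounded g ->
  poly_bounded (fun x => loop (f x) (g x)).
Proof.
move=> fp gp.
have [q fq] := poly_bounded_add (poly_bounded_const 1)
  (poly_bounded_mul fp (poly_bounded_add gp (poly_bounded_step fp))).
by exists q => x; apply: leq_trans (fq x); rewrite /loop /step addnA.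
Qed.

Lemma poly_bounded_reduction_cost f : poly_bounded f ->
  poly_bounded (fun x => reduction_cost x (f x)).
Proof.
move=> fp; rewrite /reduction_cost /closure_cost /stage_cost /delete_cost /copy_cost.
rewrite /search_cost /clear_cost /diff_cost.
by do ![exact: fp | exact: poly_bounded_const | exact: poly_bounded_id
  | apply: poly_bounded_step | apply: poly_bounded_loop | apply: poly_bounded_add
  | apply: poly_bounded_mul].
Qed.

(** For fixed [p] this is linear in the input size [x]. The factor [2 * x + 1] adds [x], for the
    cells of the rows, and [x + 1], for their number. *)
Definition space_bound p x := 4 + 2 ^ p * (2 * x + 1) + x.

Definition output_bound p x := 2 * x + 2 + 2 ^ p * (2 * x + 1).

Lemma downset_bounds n p (F : {set {set 'I_n}}) (t : int) (s : seq {set 'I_n}) :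
  (forall A, A \in F -> #|A| <= p) -> uniq s -> s =i F ->
  let x := input_size (family_word t s) in
  (0 < size s -> 4 + (#|downset F|).+1 * n + #|downset F| <= space_bound p x) /\
  input_size (family_word (clip n t) (close_rows s)) <= output_bound p x.
Proof.
move=> Fp us sF x; have xE : x = _ := input_size_family t s.
have sizeF : #|F| = size s.
  by rewrite cardE; apply: perm_size; apply: uniq_perm; rewrite ?enum_uniq // => A;
    rewrite mem_enum sF.
have sd : size (close_rows s) = #|downset F|.
  rewrite cardE; apply: perm_size; apply: uniq_perm; rewrite ?enum_uniq //.
    exact: close_rows_uniq.
  by move=> A; rewrite mem_enum (mem_close_rows sF).
have dF : #|downset F| <= size s * 2 ^ p by rewrite -sizeF; exact: card_downset.
(* Each row has [n] cells, so for positive [n] the input is at least as long as the list. Over the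
   empty universe there is at most one set. *)
have s_x : size s <= x + 1.
  have [n0|n0] := posnP n.
    have : size s <= 2 ^ n.
      rewrite -sizeF; apply: leq_trans (subset_leq_card (finset.subsetT F)) _.
      by rewrite -powersetT card_powerset cardsT card_ord.
    have -> : 2 ^ n = 1 by rewrite n0.
    lia.
  have : size s <= size s * n by rewrite leq_pmulr.
  by lia.
have dFn : #|downset F| * n <= 2 ^ p * x.
  apply: (@leq_trans (size s * 2 ^ p * n)); first by rewrite leq_mul2r dF orbT.
  by rewrite mulnAC mulnC leq_mul2l; apply/orP; right; lia.
have dFx : #|downset F| <= 2 ^ p * (x + 1).
  by apply: leq_trans dF _; rewrite mulnC leq_mul2l s_x orbT.
rewrite input_size_family sd /space_bound /output_bound.
move: {sd sizeF dF} #|downset F| (2 ^ p) dFn dFx => d e dFn dFx; split.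
  by move=> s0; have : n <= size s * n by [rewrite leq_pmull]; lia.
have : bitlen `|clip n t| <= bitlen `|t|.
  by apply: leq_bitlen; rewrite /clip; case: ifP => // _; exact: geq_minl.
by have := bitlen_le d; lia.
Qed.

Lemma solvable_cover (R : realType) p (eps : R) : (0 < eps)%R ->
  solvable (set_partitioning p) eps -> solvable (set_cover p) eps.
Proof.
move=> eps0 [P [q Pq]].
have [q' q'P] : poly_bounded (fun x =>
    reduction_cost x (space_bound p x) + q.[output_bound p x]%R).
  apply: poly_bounded_add; [apply: poly_bounded_reduction_cost|apply: poly_bounded_horner];
  by do ![exact: poly_bounded_const | exact: poly_bounded_id
    | apply: poly_bounded_add | apply: poly_bounded_mul].
exists (Seq reduction P), q' => /= I w [s sI ->].
have us : uniq s by rewrite (perm_uniq sI) enum_uniq.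
have sF : s =i members I by move=> A; rewrite (perm_mem sI) mem_enum.
pose I' := downset_instance I; pose w' := family_word (target I') (close_rows s).
have [T [Tle run err]] : exists T : nat,
    [/\ (T%:R <= 2 `^ (eps * (univ I)%:R) * (q.[input_size w'])%:R)%R,
    runs_in P w' T & (error_prob R P w' T (has_partitioning I') <= 1 / 3)%R].
  apply: (Pq I'); exists (close_rows s) => //.
  apply: uniq_perm => [||A]; [exact: close_rows_uniq|exact: enum_uniq|].
  by rewrite mem_enum (mem_close_rows sF).
have [] := downset_bounds (target I) (@members_le p I) us sF.
set x := input_size _ => space_le out_le.
have xE : x = _ := input_size_family (target I) s.
have [||||k [st [redE [kle stE]]]] := @reduction_wp _ (target I) _ s x (space_bound p x) us sF.
- by lia.
- by lia.
- by lia.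
- exact: space_le.
rewrite stE in redE; exists (k + T); split.
(* As [eps] is positive, the exponential factor is at least 1, and the polynomial cost of the
   reduction is absorbed in the product. *)
- have pow1 : (1 <= 2 `^ (eps * (univ I)%:R) :> R)%R.
    rewrite -[leLHS](powRr0 2) ler_powR ?ler1n // mulr_ge0 ?ler0n //.
    exact: ltW.
  apply: (@le_trans _ _ (2 `^ (eps * (univ I)%:R) *
      (reduction_cost x (space_bound p x) + q.[output_bound p x]%R)%:R)%R); last first.
    by rewrite ler_wpM2l ?powR_ge0 // ler_nat q'P.
  rewrite natrD [X in (_ <= _ * X)%R]natrD mulrDr lerD //.
    apply: (@le_trans _ _ (1 * (reduction_cost x (space_bound p x))%:R)%R).
      by rewrite mul1r ler_nat.
    exact: (ler_wpM2r (ler0n _ _) pow1).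
  apply: le_trans Tle _; rewrite ler_wpM2l ?powR_ge0 // ler_nat.
  exact: horner_mono.
- exact: runs_in_seq redE _ run.
- apply: le_trans (error_prob_seq redE R _ run) _.
  suff -> : has_cover I = has_partitioning I' by [].
  by rewrite /has_cover -cover_iff_partitioning.
Qed.

(** * Monotonicity in [p] and the limits *)

Definition widen_instance p p' (pp' : p <= p') (I : bounded_family p) : bounded_family p' :=
  BoundedFamily (target I) (fun A IA => leq_trans (@members_le p I A IA) pp').

(** The algorithm for [p'] works as it stands: widening changes neither the encodings nor the
    parameter nor the answer. *)
Lemma solvable_cover_le (R : realType) p p' (eps : R) : p <= p' ->
  solvable (set_cover p') eps -> solvable (set_cover p) eps.
Proof.
by move=> pp' [P [q Pq]]; exists P, q => I w; exact: (Pq (widen_instance pp' I)).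
Qed.

Lemma solvable_partitioning_le (R : realType) p p' (eps : R) : p <= p' ->
  solvable (set_partitioning p') eps -> solvable (set_partitioning p) eps.
Proof.
by move=> pp' [P [q Pq]]; exists P, q => I w; exact: (Pq (widen_instance pp' I)).
Qed.

(** An infimum over a larger set of exponents is smaller. *)
Lemma sigma_le (R : realType) (Pi Pi' : problem) :
  (forall eps : R, (0 < eps)%R -> solvable Pi' eps -> solvable Pi eps) ->
  (sigma R Pi <= sigma R Pi')%E.
Proof.
move=> PiPi'; apply: ereal_inf_le_tmp => _ [eps [eps0 Pi'eps] <-].
by exists eps => //; split=> //; exact: PiPi'.
Qed.

Theorem theorem22 (R : realType) :
  [/\ cvgn (fun p => sigma R (set_cover p)),
      cvgn (fun p => sigma R (set_partitioning p))
    & (limn (fun p => sigma R (set_cover p)) <=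
       limn (fun p => sigma R (set_partitioning p)))%E].
Proof.
have cvg_cover : cvgn (fun p => sigma R (set_cover p)).
  apply: ereal_nondecreasing_is_cvgn => p p' pp'; apply: sigma_le => eps _.
  exact: solvable_cover_le.
have cvg_part : cvgn (fun p => sigma R (set_partitioning p)).
  apply: ereal_nondecreasing_is_cvgn => p p' pp'; apply: sigma_le => eps _.
  exact: solvable_partitioning_le.
split=> //; apply: lee_lim => //; apply: nearW => p; apply: sigma_le => eps eps0.
exact: solvable_cover.
Qed.
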